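(* For every integer $n \ge 3$, the cycle $C_n$ satisfies $$\mathrm{gp}(S(C_n)) = \begin{cases} n, & \text{if } n \le 7,\\ 6, & \text{if } n \ge 8.\end{cases}$$
   Context: The shadow graph $S(G)$ of a graph $G$ is obtained from $G$ by adding, for each vertex $v$ of $G$, a new vertex $v'$ (the shadow vertex of $v$), and joining $v'$ to all neighbours of $v$ in $G$ (shadow vertices are pairwise non-adjacent). A set $S$ of vertices of a graph is a general position set if no three distinct vertices of $S$ lie on a common shortest path (geodesic); the general position number $\mathrm{gp}(H)$ is the maximum cardinality of a general position set of $H$. *)

(* Defs.v *)
From mathcomp Require Import all_boot.
From mathcomp Require Import boolp.

Set Implicit Arguments.
Unset Strict Implicit.
Unset Printing Implicit Defensive.

Record sgraph := SGraph {
  vertex :> finType;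
  edge : rel vertex;
  edge_sym : symmetric edge;
  edge_irr : irreflexive edge
}.

Arguments edge {_} _ _.

Section Cycle.
Variable n : nat.

(* The guard [i != j] only matters for [n = 1]. *)
Definition cycle_rel : rel 'I_n :=
  fun i j => (i != j) && ((j == ordS i) || (i == ordS j)).

Lemma cycle_rel_sym : symmetric cycle_rel.
Proof. by move=> i j; rewrite /cycle_rel eq_sym orbC. Qed.

Lemma cycle_rel_irr : irreflexive cycle_rel.
Proof. by move=> i; rewrite /cycle_rel eqxx. Qed.

Definition cycle_graph : sgraph := SGraph cycle_rel_sym cycle_rel_irr.

End Cycle.

Section Shadow.
Variable G : sgraph.

(* [inl v] is the original vertex v, [inr v] its shadow vertex v'. *)
Definition shadow_rel : rel (G + G)%type :=
  fun a b =>
    match a, b with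
    | inl u, inl v => edge u v
    | inl u, inr v => edge u v
    | inr u, inl v => edge u v
    | inr _, inr _ => false
    end.

Lemma shadow_rel_sym : symmetric shadow_rel.
Proof. by case=> u [] v //=; apply: edge_sym. Qed.

Lemma shadow_rel_irr : irreflexive shadow_rel.
Proof. by case=> u //=; apply: edge_irr. Qed.

Definition shadow_graph : sgraph := SGraph shadow_rel_sym shadow_rel_irr.

End Shadow.

Section GeneralPosition.
Variable G : sgraph.

(* The walk [x :: p] is a shortest one between its end vertices; minimality
   of the length forces its vertices to be distinct. *)
Definition geodesic (x : G) (p : seq G) : Prop :=
  path edge x p /\
  forall q : seq G, path edge x q -> last x q = last x p -> size p <= size q.

Definition general_position (S : {set G}) : Prop :=
  forall u v w : G, u \in S -> v \in S -> w \in S ->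
    u != v -> v != w -> u != w ->
    ~ exists (x : G) (p : seq G),
        geodesic x p /\ [/\ u \in x :: p, v \in x :: p & w \in x :: p].

Definition gp : nat :=
  \max_(S : {set G} | `[< general_position S >]) #|S|.

End GeneralPosition.

(* Main.v *)
Require Import Defs.
From mathcomp Require Import all_boot.
From mathcomp Require Import boolp zify.

(** Distances in the shadow graph of a cycle are cycle distances, except that a
vertex is at distance 2 from its own shadow and that shadows of adjacent
vertices are at distance 3 (2 for the triangle).

Upper bound.  If a general position set S contains an edge and n >= 4, every
other vertex of S lies over the point equidistant from its two ends, so
|S| <= 4.  Otherwise S is independent, and sending the shadow of i to i and the
original vertex i to i + 1 is an injection of S into the cycle, so |S| <= n.  If
moreover n >= 8 and |S| >= 7, then four image points are pairwise at distance at
least 2; by independence so are the four underlying positions, and three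
of them lie on a common half of the cycle, hence on a geodesic.  The triangle is
settled by enumeration.

Lower bound.  For n <= 7 all distances between shadows are 2 or 3, so the
shadows are in general position; for n >= 8 take both copies of the vertices
0, n/3 and 2n/3. *)

Set Implicit Arguments.
Unset Strict Implicit.
Unset Printing Implicit Defensive.

(** * General position expressed through a distance function *)

Lemma nat_order3 (i j k : nat) :
  [\/ i <= j <= k, i <= k <= j | k <= i <= j] \/
  [\/ j <= i <= k, j <= k <= i | k <= j <= i].
Proof.
have [ij|ji] := leqP i j; have [jk|kj] := leqP j k; have [ik|ki] := leqP i k;
  by [left; constructor; lia | right; constructor; lia].
Qed.

Section DistanceCriterion.
Variables (G : sgraph) (d : G -> G -> nat).
(** Together these properties identify [d] with the graph distance: [d_refl] and [d_lip] bound the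
    length of every walk from below, and [d_step] builds a walk of length [d x y] backwards from
    [y]. *)
Hypothesis d_refl : forall x, d x x = 0.
Hypothesis d_lip : forall x y z, edge y z -> d x z <= (d x y).+1.
Hypothesis d_step : forall x y, x != y ->
  exists2 z, edge z y & d x y = (d x z).+1.

Lemma path_dist_le x y p : path edge y p -> d x (last y p) <= d x y + size p.
Proof.
elim: p y => [|z p IH] y /=; first by rewrite addn0.
case/andP=> /(d_lip x) Hyz /IH; lia.
Qed.

Lemma path_of_dist x y :
  exists p, [/\ path edge x p, last x p = y & size p = d x y].
Proof.
move Dk: (d x y) => k; elim: k y Dk => [|k IH] y Dk.
  have [->|/d_step[z _]] := eqVneq x y; first by exists [::].
  by rewrite Dk.
have xy : x != y by apply/eqP => xy; rewrite xy d_refl in Dk.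
have [z zy Dz] := d_step xy.
have [p [pp lp sp]] := IH z ltac:(lia).
by exists (rcons p y); rewrite rcons_path pp lp last_rcons size_rcons sp.
Qed.

Lemma dist_triangle x y z : d x z <= d x y + d y z.
Proof. by have [p [pp <- <-]] := path_of_dist y z; apply: path_dist_le. Qed.

Lemma geodesic_size x p : geodesic x p -> size p = d x (last x p).
Proof.
case=> pp minp; have [q [pq lq sq]] := path_of_dist x (last x p).
have := minp q pq lq; have := path_dist_le x pp; rewrite d_refl; lia.
Qed.

Lemma path_nth_dist_le x p i j : path edge x p -> i <= j <= size p ->
  d (nth x (x :: p) i) (nth x (x :: p) j) <= j - i.
Proof.
move=> pp; elim: j => [|j IH] ij.
  have -> : i = 0 by lia.
  by rewrite d_refl.
have [->|nij] := eqVneq i j.+1; first by rewrite d_refl.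
have /(pathP x)/(_ j) := pp => /(_ ltac:(lia)) ej.
have := d_lip (nth x (x :: p) i) ej.
by have := IH ltac:(lia); rewrite /=; lia.
Qed.

(** Each stretch of the walk bounds the distance of its ends by its length, while the whole length
    equals the distance of the extreme vertices. By the triangle inequality all these bounds are
    equalities. *)
Lemma geodesic_between x p i j k : geodesic x p -> i <= j <= k -> k <= size p ->
  d (nth x (x :: p) i) (nth x (x :: p) j) +
  d (nth x (x :: p) j) (nth x (x :: p) k) =
  d (nth x (x :: p) i) (nth x (x :: p) k).
Proof.
move=> gp ijk kp; have sp := geodesic_size gp; case: gp => pp _.
set u := nth _ _ i; set v := nth _ _ j; set w := nth _ _ k.
have xu : d x u <= i - 0 by apply: (path_nth_dist_le (i := 0)) => //; lia.
have uv : d u v <= j - i by apply: path_nth_dist_le => //; lia.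
have vw : d v w <= k - j by apply: path_nth_dist_le => //; lia.
have wl : d w (last x p) <= size p - k.
  have := @path_nth_dist_le x p k (size p) pp ltac:(lia).
  by rewrite -(last_nth x x p).
have := dist_triangle x u (last x p); have := dist_triangle u w (last x p).
by have := dist_triangle u v w; lia.
Qed.

(** If [v] is metrically between [u] and [w], joining shortest walks from [u] to [v] and from [v] to
    [w] gives a geodesic. Conversely, three vertices of a geodesic, sorted by index, satisfy the
    distance equality. *)
Lemma general_positionP (S : {set G}) :
  general_position S <->
  (forall u v w, u \in S -> v \in S -> w \in S ->
     u != v -> v != w -> u != w -> d u v + d v w <> d u w).
Proof.
split=> H u v w uS vS wS uv vw uw.
  move=> E; apply: (H u v w) => //.
  have [p [pp lp sp]] := path_of_dist u v.
  have [q [pq lq sq]] := path_of_dist v w.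
  exists u, (p ++ q); split; first split.
  - by rewrite cat_path pp lp.
  - move=> r pr; rewrite last_cat lp lq size_cat sp sq E => lr.
    by have := path_dist_le u pr; rewrite lr d_refl.
  - split; first by rewrite inE eqxx.
    + by rewrite -cat_cons mem_cat -lp mem_last.
    + by rewrite -lq -lp -last_cat mem_last.
case=> x [p [gp [up vp wp]]].
have [i iI Ei] : exists2 i, i <= size p & nth x (x :: p) i = u.
  by have /(nthP x)[i] := up; exists i.
have [j jI Ej] : exists2 i, i <= size p & nth x (x :: p) i = v.
  by have /(nthP x)[j] := vp; exists j.
have [k kI Ek] : exists2 i, i <= size p & nth x (x :: p) i = w.
  by have /(nthP x)[k] := wp; exists k.
have B := geodesic_between gp.
case: (nat_order3 i j k) => [[ijk|ikj|kij]|[jik|jki|kji]].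
- by have := B i j k ijk kI; rewrite Ei Ej Ek; apply: H.
- by have := B i k j ikj jI; rewrite Ei Ej Ek; apply: H; rewrite // eq_sym.
- by have := B k i j kij jI; rewrite Ei Ej Ek; apply: H; rewrite // eq_sym.
- by have := B j i k jik kI; rewrite Ei Ej Ek; apply: H; rewrite // eq_sym.
- by have := B j k i jki iI; rewrite Ei Ej Ek; apply: H; rewrite // eq_sym.
- by have := B k j i kji iI; rewrite Ei Ej Ek; apply: H; rewrite // eq_sym.
Qed.

End DistanceCriterion.

(** * Distances in the cycle and in its shadow graph *)

(** Subtraction is truncated, so [e] is the absolute difference; [e] and [n - e] are the lengths of
    the two arcs. *)
Definition cycle_dist n i j : nat :=
  let e := (i - j) + (j - i) in minn e (n - e).

(* [i], [j] are positions on the cycle; [a], [b] tell whether the vertex is a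
   shadow. *)
Definition shadow_dist n i (a : bool) j (b : bool) : nat :=
  if (i == j) && (a == b) then 0 else
  if i == j then 2 else
  if (cycle_dist n i j == 1) && a && b then (if n == 3 then 2 else 3)
  else cycle_dist n i j.

Lemma cycle_distC n i j : cycle_dist n i j = cycle_dist n j i.
Proof. by rewrite /cycle_dist; lia. Qed.

Lemma cycle_dist_eq0 n i j : i < n -> j < n -> (cycle_dist n i j == 0) = (i == j).
Proof. by rewrite /cycle_dist; lia. Qed.

Lemma shadow_distC n i a j b : shadow_dist n i a j b = shadow_dist n j b i a.
Proof.
by rewrite /shadow_dist cycle_distC eq_sym [b == a]eq_sym -!andbA [a && b]andbC.
Qed.

Lemma shadow_dist_twin n i a b : shadow_dist n i a i b = if a == b then 0 else 2.
Proof. by rewrite /shadow_dist eqxx. Qed.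

Lemma shadow_dist_near n i a j b : cycle_dist n i j = 1 ->
  shadow_dist n i a j b = if a && b then (if n == 3 then 2 else 3) else 1.
Proof.
move=> c1; rewrite /shadow_dist c1 /=; have [ij|//] := eqVneq i j.
by move: c1; rewrite ij /cycle_dist; lia.
Qed.

Lemma shadow_dist_far n i a j b :
  1 < cycle_dist n i j -> shadow_dist n i a j b = cycle_dist n i j.
Proof.
move=> far; rewrite /shadow_dist.
have -> : (i == j) = false by move: far; rewrite /cycle_dist; lia.
by rewrite /=; case: eqP => // c1; rewrite c1 in far.
Qed.

Lemma shadow_dist_orig n i a j b : i != j -> ~~ (a && b) ->
  shadow_dist n i a j b = cycle_dist n i j.
Proof. by rewrite /shadow_dist -andbA => /negPf-> /negPf->; rewrite andbF. Qed.

Lemma cycle_dist_cases n i j : i < n -> j < n ->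
  [\/ i = j, cycle_dist n i j = 1 | 1 < cycle_dist n i j].
Proof.
move=> iN jN; case Dc: (cycle_dist n i j) => [|[|m]]; last by constructor 3.
  by constructor 1; apply/eqP; rewrite -(cycle_dist_eq0 iN jN) Dc.
by constructor 2.
Qed.

Lemma cycle_dist_lip n i j k : i < n -> j < n -> k < n ->
  cycle_dist n j k = 1 -> cycle_dist n i k <= (cycle_dist n i j).+1.
Proof. by rewrite /cycle_dist; lia. Qed.

Lemma cycle_dist1P n i j : i < n -> j < n -> cycle_dist n i j = 1 ->
  [\/ j = i.+1, i = j.+1, (i = 0 /\ j = n.-1) | (j = 0 /\ i = n.-1)].
Proof.
rewrite /cycle_dist => iN jN ij.
have [|h1] := eqVneq j i.+1; first by constructor 1.
have [|h2] := eqVneq i j.+1; first by constructor 2.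
by have [h3|h3] := posnP i; [constructor 3 | constructor 4]; lia.
Qed.

(** Three steps of +1 or -1 add up to an odd number of absolute value at most 3, never a multiple of
    [n]. *)
Lemma cycle_triangle_free n i j k : 4 <= n -> i < n -> j < n -> k < n ->
  cycle_dist n i j = 1 -> cycle_dist n i k = 1 -> cycle_dist n j k = 1 -> False.
Proof.
move=> n4 iN jN kN /(cycle_dist1P iN jN) ij /(cycle_dist1P iN kN) ik
  /(cycle_dist1P jN kN) jk.
by case: ij => ij; case: ik => ik; case: jk => jk; lia.
Qed.

(** The hypotheses on [j] and [k] express adjacency. Position [i] can be next to both only in the
    triangle, where all the distances involved are 1 or 2. *)
Lemma shadow_dist_lip n i a j b k c : 3 <= n -> i < n -> j < n -> k < n ->
  cycle_dist n j k = 1 -> ~~ (b && c) ->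
  shadow_dist n i a k c <= (shadow_dist n i a j b).+1.
Proof.
move=> n3 iN jN kN c1 nbc; have L := cycle_dist_lip iN jN kN c1.
have [ij|ij|ij] := cycle_dist_cases iN jN.
- subst j; rewrite shadow_dist_twin (shadow_dist_near _ _ c1).
  by case: a b c nbc => -[] [] //= _; case: ifP.
- rewrite (shadow_dist_near _ _ ij).
  have [ik|ik|ik] := cycle_dist_cases iN kN.
  + by subst k; rewrite shadow_dist_twin; case: a b c nbc => -[] [] //= _; case: ifP.
  + rewrite (shadow_dist_near _ _ ik); case: (eqVneq n 3) => n3'.
      by case: (a && c); case: (a && b).
    by case: (cycle_triangle_free _ iN jN kN ij ik c1); lia.
  + by rewrite shadow_dist_far //; case: (a && b); [case: (n == 3)|]; lia.
- rewrite (shadow_dist_far _ _ ij); have [ik|ik|ik] := cycle_dist_cases iN kN.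
  + by subst k; move: c1 ij; rewrite cycle_distC => ->.
  + by rewrite (shadow_dist_near _ _ ik); case: (a && c); [case: (n == 3)|]; lia.
  + by rewrite shadow_dist_far.
Qed.

Lemma cycle_dist_step n i j : i < n -> j < n -> 0 < cycle_dist n i j ->
  exists k, [/\ k < n, cycle_dist n k j = 1 & cycle_dist n i j = (cycle_dist n i k).+1].
Proof.
rewrite /cycle_dist => iN jN ij.
(* The witness is the neighbour of [j] on a shortest arc towards [i], wrapping around at 0 or
   [n - 1] when that arc is the outer one. *)
case: (ltnP i j) => lij; case: (leqP ((i - j + (j - i)).*2) n) => half.
- by exists j.-1; split; lia.
- by have [jn|jn] := eqVneq j.+1 n; [exists 0 | exists j.+1]; split; lia.
- by exists j.+1; split; lia.
- by have [j0|j0] := posnP j; [exists n.-1 | exists j.-1]; split; lia.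
Qed.

(** The last vertex before the end is chosen original, hence adjacent to either copy of [j], unless
    the two vertices are themselves adjacent. Between shadows over adjacent positions it is the
    third vertex of the triangle, or for larger [n] the original of [i], at distance 2 from its
    shadow. *)
Lemma shadow_dist_step n i a j b : 3 <= n -> i < n -> j < n ->
  ~~ ((i == j) && (a == b)) ->
  exists k c, [/\ k < n, cycle_dist n k j = 1, ~~ (c && b) &
     shadow_dist n i a j b = (shadow_dist n i a k c).+1].
Proof.
move=> n3 iN jN ne; have [ij|ij|ij] := cycle_dist_cases iN jN.
- subst j; rewrite eqxx /= in ne.
  have [k kN ik] : exists2 k, k < n & cycle_dist n k i = 1.
    exists (if i == 0 then 1 else i.-1); case: eqP; rewrite /cycle_dist; lia.
  exists k, false; split=> //.
  rewrite shadow_dist_twin (negPf ne) shadow_dist_near ?andbF //.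
  by rewrite cycle_distC.
- case ab: (a && b); last first.
    by exists i, a; rewrite ab shadow_dist_near // ab shadow_dist_twin eqxx.
  case/andP: ab => -> ->; have [n3'|n3'] := eqVneq n 3.
    have [k [kN kj ik]] : exists k, [/\ k < n, cycle_dist n k j = 1 & cycle_dist n i k = 1].
      by subst n; case: i j iN jN ij {ne} => [|[|[|//]]] [|[|[|//]]] // _ _ _;
        [exists 2 | exists 1 | exists 2 | exists 0 | exists 1 | exists 0].
    by exists k, false; split=> //; rewrite !shadow_dist_near // n3'.
  exists i, false; split=> //.
  by rewrite shadow_dist_near // shadow_dist_twin /= (negPf n3').
- have [k [kN kj E]] := cycle_dist_step iN jN ltac:(lia).
  exists k, false; split=> //; rewrite shadow_dist_far // E shadow_dist_orig ?andbF //.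
  by rewrite -(cycle_dist_eq0 iN kN); lia.
Qed.

(** * Vertices equidistant from the ends of an edge *)

(** Distances to the two ends of an edge differ by at most one, and a difference of one puts an end
    between the other two vertices. A twin of an end, or a vertex over a neighbouring position, has
    distances 2 and 1 or 2 and 3; so [k] is far from both ends, where shadow and cycle distances
    agree. *)
Lemma edge_equidistant n i a j b k c : 4 <= n -> i < n -> j < n -> k < n ->
  cycle_dist n i j = 1 -> ~~ (a && b) ->
  ~~ ((i == k) && (a == c)) -> ~~ ((j == k) && (b == c)) ->
  shadow_dist n i a j b + shadow_dist n j b k c <> shadow_dist n i a k c ->
  shadow_dist n j b i a + shadow_dist n i a k c <> shadow_dist n j b k c ->
  shadow_dist n i a k c + shadow_dist n k c j b <> shadow_dist n i a j b ->
  cycle_dist n i k = cycle_dist n j k.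
Proof.
move=> n4 iN jN kN ij nab nac nbc.
have n3 : (n == 3) = false by lia.
rewrite [shadow_dist n j b i a]shadow_distC [shadow_dist n k c _ _]shadow_distC.
rewrite (shadow_dist_near _ _ ij) (negPf nab).
have [ik|ik|ik] := cycle_dist_cases iN kN.
- subst k; rewrite eqxx /= in nac; rewrite shadow_dist_twin (negPf nac).
  rewrite shadow_dist_near 1?cycle_distC // n3.
  by case: (b && c); lia.
- rewrite (shadow_dist_near _ _ ik) n3.
  have [jk|jk|jk] := cycle_dist_cases jN kN.
  + subst k; rewrite eqxx /= in nbc; rewrite shadow_dist_twin (negPf nbc).
    by case: (a && c); lia.
  + by case: (cycle_triangle_free n4 iN jN kN ij ik jk).
  + have jk2 : cycle_dist n j k = 2.
      by have := cycle_dist_lip jN iN kN ik; rewrite (cycle_distC n j i) ij; lia.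
    by rewrite shadow_dist_far // jk2; case: (a && c); lia.
- rewrite (shadow_dist_far _ _ ik); have [jk|jk|jk] := cycle_dist_cases jN kN.
  + by subst k; rewrite ij in ik.
  + have ik2 : cycle_dist n i k = 2.
      by have := cycle_dist_lip iN jN kN jk; rewrite ij; lia.
    by rewrite (shadow_dist_near _ _ jk) n3 ik2; case: (b && c); lia.
  + rewrite shadow_dist_far // => ne1 ne2 _.
    have L1 := cycle_dist_lip kN iN jN ij.
    have L2 := cycle_dist_lip kN jN iN (etrans (cycle_distC _ _ _) ij).
    by move: L1 L2; rewrite ![cycle_dist n k _]cycle_distC; lia.
Qed.

(** Here [k] is the midpoint of the long arc from [i] to [j], so its double is [i + j] modulo [n].
    For consecutive integers that sum is odd and must be shifted by [n], in the direction that keeps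
    [k] in range; for the edge joining 0 and [n - 1] no shift occurs. *)
Lemma equidistant_double n i j k : i < n -> j < n -> k < n ->
  cycle_dist n i j = 1 -> cycle_dist n i k = cycle_dist n j k ->
  k.*2 = if (j == i.+1) || (i == j.+1) then
           (if i + j < n then i + j + n else i + j - n) else n.-1.
Proof.
move=> iN jN kN ij E.
suff : if (j == i.+1) || (i == j.+1) then
    (k.*2 == i + j + n) || (k.*2 + n == i + j) else k.*2 == n.-1.
  by case: ifP => _; [case: ltnP|]; lia.
move: E; rewrite /cycle_dist.
by case: (cycle_dist1P iN jN ij) => [->|->|[-> ->]|[-> ->]];
  case: ifPn; lia.
Qed.

Lemma equidistant_unique n i j k l : i < n -> j < n -> k < n -> l < n ->
  cycle_dist n i j = 1 -> cycle_dist n i k = cycle_dist n j k ->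
  cycle_dist n i l = cycle_dist n j l -> k = l.
Proof.
move=> iN jN kN lN ij /(equidistant_double iN jN kN ij) Dk.
by move=> /(equidistant_double iN jN lN ij); rewrite -Dk => /double_inj.
Qed.

(** * Four points spread around the cycle *)

Lemma cycle_dist_short n i j : i <= j -> (j - i).*2 <= n -> cycle_dist n i j = j - i.
Proof. by rewrite /cycle_dist; lia. Qed.

Lemma cycle_dist_long n i j : i <= j <= n -> n <= (j - i).*2 ->
  cycle_dist n i j = n - (j - i).
Proof. by rewrite /cycle_dist; lia. Qed.

(* One of the arcs [p1 p3] and [p3 p1] is at most half of the cycle. *)
Lemma four_points_between n p1 p2 p3 p4 : p1 < p2 < p3 -> p3 < p4 < n ->
  cycle_dist n p1 p2 + cycle_dist n p2 p3 = cycle_dist n p1 p3 \/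
  cycle_dist n p3 p4 + cycle_dist n p4 p1 = cycle_dist n p3 p1.
Proof.
move=> p123 p34; have [short|long] := leqP (p3 - p1).*2 n; [left|right].
  by rewrite !cycle_dist_short; lia.
rewrite ![cycle_dist n _ p1]cycle_distC cycle_dist_short; try lia.
by rewrite !cycle_dist_long; lia.
Qed.

(** Seven points cannot fill a cycle of length at least 8, so two cyclically consecutive ones are at
    least 2 apart. Keep both ends of that gap and, from there on, every second point. *)
Lemma four_spread n s : 8 <= n -> sorted ltn s -> all (fun t => t < n) s ->
  7 <= size s -> exists t1 t2 t3 t4,
  [/\ [/\ t1 \in s, t2 \in s, t3 \in s & t4 \in s],
      [&& t1.+1 < t2, t2.+1 < t3 & t3.+1 < t4] & t4.+1 < t1 + n].
Proof.
move=> n8; case: s => [|a[|b[|c[|e[|f[|g[|h s]]]]]]] //= so al _.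
have [ah|ah] := ltnP h.+1 (a + n).
  by exists a, c, f, h; rewrite !inE !eqxx !orbT; split=> //; lia.
(* Now [a] is 0 and [h] is [n - 1]: an eighth point does not fit, and the gap lies between two of
   the seven listed in order. *)
case: s so al => [|k s] /= so al; last by lia.
have [ab|ab] := ltnP a.+1 b.
  by exists a, b, e, g; rewrite !inE !eqxx !orbT; split=> //; lia.
have [bc|bc] := ltnP b.+1 c.
  by exists b, c, f, h; rewrite !inE !eqxx !orbT; split=> //; lia.
have [ce|ce] := ltnP c.+1 e.
  by exists a, c, e, g; rewrite !inE !eqxx !orbT; split=> //; lia.
have [ef|ef] := ltnP e.+1 f.
  by exists b, e, f, h; rewrite !inE !eqxx !orbT; split=> //; lia.
have [fg|fg] := ltnP f.+1 g.
  by exists a, c, f, g; rewrite !inE !eqxx !orbT; split=> //; lia.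
by exists b, e, g, h; rewrite !inE !eqxx !orbT; split=> //; lia.
Qed.

(** * The triangle, by enumeration *)

(** Vertices are coded as plain pairs of a position and a shadow flag, so that the check over all
    quadruples can be evaluated. *)
Definition C3_vertices : seq (nat * bool) :=
  [seq (i, b) | i <- iota 0 3, b <- [:: false; true]].

Lemma C3_four_between s : size s = 4 -> uniq s -> all (mem C3_vertices) s ->
  exists u v w, [/\ [/\ u \in s, v \in s & w \in s],
    u != v, v != w, u != w &
    shadow_dist 3 u.1 u.2 v.1 v.2 + shadow_dist 3 v.1 v.2 w.1 w.2
      = shadow_dist 3 u.1 u.2 w.1 w.2].
Proof.
have check : all (fun x => all (fun y => all (fun z => all (fun t =>
    let l := [:: x; y; z; t] in uniq l ==>
    has (fun u => has (fun v => has (fun w =>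
      [&& u != v, v != w, u != w &
        shadow_dist 3 u.1 u.2 v.1 v.2 + shadow_dist 3 v.1 v.2 w.1 w.2
          == shadow_dist 3 u.1 u.2 w.1 w.2]) l) l) l)
  C3_vertices) C3_vertices) C3_vertices) C3_vertices by vm_compute.
case: s => [|x[|y[|z[|t[]]]]] // _ us /and5P[xV yV zV tV _].
move/allP/(_ x xV)/allP/(_ y yV)/allP/(_ z zV)/allP/(_ t tV)/implyP/(_ us): check.
case/hasP=> u us' /hasP[v vs] /hasP[w ws] /and4P[uv vw uw /eqP E].
by exists u, v, w.
Qed.

(** * Transfer to the vertices of the shadow graph *)

Section ShadowCycle.
Variable n : nat.
Hypothesis n3 : 3 <= n.
Local Notation G := (shadow_graph (cycle_graph n)).

Definition base (x : G) : 'I_n := match x with inl i => i | inr i => i end.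
Definition is_shadow (x : G) : bool := if x is inr _ then true else false.
Definition shadow_cycle_dist (x y : G) : nat :=
  shadow_dist n (base x) (is_shadow x) (base y) (is_shadow y).
Local Notation d := shadow_cycle_dist.

Definition mk_vertex (i : 'I_n) (b : bool) : G := if b then inr i else inl i.

Lemma base_mk i b : base (mk_vertex i b) = i. Proof. by case: b. Qed.
Lemma is_shadow_mk i b : is_shadow (mk_vertex i b) = b. Proof. by case: b. Qed.

Lemma vertex_eqE (x y : G) :
  (x == y) = (base x == base y :> nat) && (is_shadow x == is_shadow y).
Proof. by case: x => i; case: y => j /=; rewrite ?andbT ?andbF. Qed.

Lemma val_ordSP (i : 'I_n) :
  (i.+1 = n /\ ordS i = 0 :> nat) \/ (i.+1 < n /\ ordS i = i.+1 :> nat).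
Proof.
have := ltn_ord i; rewrite leq_eqVlt => /orP[/eqP E|iN]; [left|right].
  by rewrite /= E modnn.
by rewrite /= modn_small.
Qed.

Lemma cycle_relE (i j : 'I_n) : cycle_rel i j = (cycle_dist n i j == 1).
Proof.
have ordE (k l : 'I_n) : (k == l) = (k == l :> nat) by [].
rewrite /cycle_rel !ordE /cycle_dist; have := ltn_ord i; have := ltn_ord j.
by case: (val_ordSP i) => -[iE ->]; case: (val_ordSP j) => -[jE ->]; lia.
Qed.

Lemma edgeE (x y : G) :
  edge x y = ~~ (is_shadow x && is_shadow y) && (cycle_dist n (base x) (base y) == 1).
Proof. by case: x => i; case: y => j //=; rewrite -cycle_relE. Qed.

Lemma shadow_cycle_dist_refl x : d x x = 0.
Proof. by rewrite /d /shadow_dist !eqxx. Qed.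

Lemma shadow_cycle_dist_lip x y z : edge y z -> d x z <= (d x y).+1.
Proof.
rewrite edgeE => /andP[ns /eqP c1].
by apply: shadow_dist_lip; rewrite ?ltn_ord.
Qed.

Lemma shadow_cycle_dist_step x y : x != y -> exists2 z, edge z y & d x y = (d x z).+1.
Proof.
rewrite vertex_eqE => /(shadow_dist_step n3 (ltn_ord _) (ltn_ord _)).
case=> k [c [kN c1 ns E]]; exists (mk_vertex (Ordinal kN) c).
  by rewrite edgeE base_mk is_shadow_mk ns c1.
by rewrite /d base_mk is_shadow_mk.
Qed.

Lemma shadow_cycle_gpP (S : {set G}) :
  general_position S <->
  (forall u v w, u \in S -> v \in S -> w \in S ->
     u != v -> v != w -> u != w -> d u v + d v w <> d u w).
Proof.
exact: (general_positionP shadow_cycle_dist_refl shadow_cycle_dist_lip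
          shadow_cycle_dist_step).
Qed.

(* For an independent set this map into the cycle is injective: the original
   vertex [i] and the shadow of [i + 1] are adjacent. *)
Definition slot (x : G) : 'I_n := if is_shadow x then base x else ordS (base x).

Lemma slotP (x : G) :
  [\/ is_shadow x = true /\ slot x = base x :> nat,
      [/\ is_shadow x = false, (base x).+1 = n & slot x = 0 :> nat] |
      [/\ is_shadow x = false, (base x).+1 < n & slot x = (base x).+1 :> nat]].
Proof.
rewrite /slot; case: (is_shadow x); first by constructor 1.
by case: (val_ordSP (base x)) => -[? ?]; [constructor 2 | constructor 3].
Qed.

(** A position equals its slot or precedes it cyclically; this carries the cyclic order of slots
    over to positions. *)
Lemma base_slot (x : G) : (slot x <= (base x).+1 <= (slot x).+1) ||
  ((slot x == 0 :> nat) && ((base x).+1 == n)).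
Proof. by case: (slotP x) => [[_ ->]|[_ -> ->]|[_ _ ->]]; lia. Qed.

(** * Upper bound *)

Section UpperBound.
Variable S : {set G}.
Hypothesis S_gp : general_position S.

Lemma gp_not_between u v w : u \in S -> v \in S -> w \in S ->
  u != v -> v != w -> u != w -> d u v + d v w <> d u w.
Proof. by move: u v w; apply/shadow_cycle_gpP. Qed.

Lemma card_gp_edge x y : 4 <= n -> x \in S -> y \in S -> edge x y -> #|S| <= 4.
Proof.
move=> n4 xS yS xy; have xny : x != y by apply: contraTneq xy => ->; rewrite edge_irr.
have Eq z : z \in S :\ x :\ y -> cycle_dist n (base x) (base z) = cycle_dist n (base y) (base z).
  rewrite !inE => /and3P[zy zx zS]; move: xy; rewrite edgeE => /andP[ns /eqP c1].
  apply: (edge_equidistant (a := is_shadow x) (b := is_shadow y) (c := is_shadow z));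
    rewrite ?ltn_ord // -?vertex_eqE 1?eq_sym //;
    by apply: gp_not_between => //; rewrite eq_sym.
(* The vertices other than [x] and [y] all lie over one position, so the shadow flag separates them
   and at most two remain. *)
have inj : {in S :\ x :\ y &, injective is_shadow}.
  move=> z t zS tS zt; apply/eqP; rewrite vertex_eqE zt eqxx andbT; apply/eqP.
  move: xy; rewrite edgeE => /andP[_ /eqP c1].
  by apply: (equidistant_unique _ _ _ _ c1 (Eq z zS) (Eq t tS)); rewrite ltn_ord.
have := max_card (is_shadow @: (S :\ x :\ y)); rewrite card_in_imset // card_bool.
by have := cardsD1 x S; have := cardsD1 y (S :\ x); lia.
Qed.

Lemma card_gp_C3 : n = 3 -> #|S| <= 3.
Proof.
move=> n3E; rewrite leqNgt; apply/negP; rewrite cardE => S4.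
pose key (x : G) := (nat_of_ord (base x), is_shadow x).
have keyV x : key x \in C3_vertices.
  rewrite /key; move: (ltn_ord (base x)); rewrite [X in _ < X]n3E.
  by case: (nat_of_ord _) => [|[|[|]]] //; case: is_shadow.
have key_inj : injective key.
  by move=> x y [bE sE]; apply/eqP; rewrite vertex_eqE bE sE !eqxx.
(* Four elements of [S], in the coding of the enumeration. *)
pose s := map key (take 4 (enum S)).
have us : uniq s by rewrite map_inj_uniq // take_uniq // enum_uniq.
have ss : size s = 4 by rewrite size_map size_takel.
have sV : all (mem C3_vertices) s by apply/allP => _ /mapP[x _ ->]; apply: keyV.
have [u [v [w [[us' vs ws] uv vw uw E]]]] := C3_four_between ss us sV.
have pre z : z \in s -> exists2 x, x \in S & z = key x.
  by case/mapP => x /mem_take; rewrite mem_enum; exists x.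
have {us'} [x xS Ex] := pre _ us'; have {vs} [y yS Ey] := pre _ vs.
have {ws} [z zS Ez] := pre _ ws.
rewrite Ex Ey Ez !(inj_eq key_inj) in uv vw uw E.
apply: (gp_not_between xS yS zS uv vw uw).
by move: E; rewrite /key /= -n3E.
Qed.

Section Independent.
Hypothesis S_indep : {in S &, forall x y, ~~ edge x y}.

Lemma slot_inj : {in S &, injective slot}.
Proof.
move=> x y xS yS /(congr1 val) /= E.
apply/eqP; rewrite vertex_eqE; move: (S_indep xS yS); rewrite edgeE /cycle_dist.
have := ltn_ord (base x); have := ltn_ord (base y).
case: (slotP x) => [[-> Ex]|[-> Ex Ex']|[-> Ex Ex']];
  case: (slotP y) => [[-> Ey]|[-> Ey Ey']|[-> Ey Ey']] /=; lia.
Qed.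

Lemma card_indep_le : #|S| <= n.
Proof. by rewrite -(card_in_imset slot_inj) -[leqRHS]card_ord max_card. Qed.

(** Replacing slots by positions shortens an arc by at most one, and only an arc from a shadow
    forward to an original. An arc of length 2 shortened to 1 would make these two vertices
    adjacent, against independence. *)
Lemma slot_far x y : x \in S -> y \in S ->
  (slot x).+1 < slot y -> (slot y).+1 < slot x + n ->
  1 < cycle_dist n (base x) (base y).
Proof.
move=> xS yS; move: (S_indep xS yS); rewrite edgeE /cycle_dist.
have := ltn_ord (base x); have := ltn_ord (base y).
case: (slotP x) => [[-> Ex]|[-> Ex Ex']|[-> Ex Ex']];
  case: (slotP y) => [[-> Ey]|[-> Ey Ey']|[-> Ey Ey']] /=; lia.
Qed.

Lemma far_not_between x y z : x \in S -> y \in S -> z \in S ->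
  1 < cycle_dist n (base x) (base y) -> 1 < cycle_dist n (base y) (base z) ->
  1 < cycle_dist n (base x) (base z) ->
  cycle_dist n (base x) (base y) + cycle_dist n (base y) (base z) <>
  cycle_dist n (base x) (base z).
Proof.
have ne u v : 1 < cycle_dist n (base u) (base v) -> u != v.
  by apply: contraTneq => ->; rewrite /cycle_dist; lia.
move=> xS yS zS xy yz xz.
have := gp_not_between xS yS zS (ne _ _ xy) (ne _ _ yz) (ne _ _ xz).
by rewrite /d !shadow_dist_far.
Qed.

Lemma card_indep_le6 : 8 <= n -> #|S| <= 6.
Proof.
move=> n8; rewrite leqNgt; apply/negP => S7.
pose s := map val (enum (slot @: S)).
have ss : sorted ltn s.
  apply: (subseq_sorted ltn_trans) (iota_ltn_sorted 0 n).
  by rewrite -val_enum_ord map_subseq // enumT filter_subseq.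
have sn : all (fun t => t < n) s by apply/allP => _ /mapP[i _ ->]; apply: ltn_ord.
have sz : 7 <= size s by rewrite size_map -cardE card_in_imset //; apply: slot_inj.
have [t1 [t2 [t3 [t4 [[i1 i2 i3 i4] g g4]]]]] := four_spread n8 ss sn sz.
have pre t : t \in s -> exists2 x, x \in S & t = slot x.
  case/mapP => i; rewrite mem_enum => /imsetP[x xS ->] ->; by exists x.
have {i1} [x1 x1S E1] := pre _ i1; have {i2} [x2 x2S E2] := pre _ i2.
have {i3} [x3 x3S E3] := pre _ i3; have {i4} [x4 x4S E4] := pre _ i4.
have far x y (t u : nat) : x \in S -> y \in S -> t = slot x -> u = slot y ->
    t.+1 < u -> u.+1 < t + n -> 1 < cycle_dist n (base x) (base y).
  by move=> xS yS -> ->; apply: slot_far.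
have [h12 h23 h34] := and3P g.
have f12 : 1 < cycle_dist n (base x1) (base x2) by apply: (far _ _ _ _ x1S x2S E1 E2); lia.
have f13 : 1 < cycle_dist n (base x1) (base x3) by apply: (far _ _ _ _ x1S x3S E1 E3); lia.
have f14 : 1 < cycle_dist n (base x1) (base x4) by apply: (far _ _ _ _ x1S x4S E1 E4); lia.
have f23 : 1 < cycle_dist n (base x2) (base x3) by apply: (far _ _ _ _ x2S x3S E2 E3); lia.
have f24 : 1 < cycle_dist n (base x2) (base x4) by apply: (far _ _ _ _ x2S x4S E2 E4); lia.
have f34 : 1 < cycle_dist n (base x3) (base x4) by apply: (far _ _ _ _ x3S x4S E3 E4); lia.
have B x y z := @far_not_between x y z.
(* Slots at least 2 apart keep their order when replaced by positions, except that slot 0 may belong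
   to position [n - 1], which moves [x1] to the end. *)
have [ord|ord] : base x1 < base x2 < base x3 /\ base x3 < base x4 < n \/
    base x2 < base x3 < base x4 /\ base x4 < base x1 < n.
  have l1 := ltn_ord (base x1); have l4 := ltn_ord (base x4).
  have [b1 b2 b3 b4] := And4 (base_slot x1) (base_slot x2) (base_slot x3) (base_slot x4).
  by clear - b1 b2 b3 b4 E1 E2 E3 E4 g g4 l1 l4; lia.
- have [] := four_points_between ord.1 ord.2; first exact: B.
  by apply: B; rewrite // cycle_distC.
- have [] := four_points_between ord.1 ord.2; first exact: B.
  by apply: B; rewrite // cycle_distC.
Qed.

End Independent.

Lemma card_gp_le : #|S| <= if n <= 7 then n else 6.
Proof.
have [n3E|n3N] := eqVneq n 3.
  by rewrite [in leqRHS]n3E; apply: card_gp_C3.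
have n4 : 4 <= n by lia.
have [/existsP[x /andP[xS /existsP[y /andP[yS xy]]]]|noedge] :=
  boolP [exists x in S, exists y in S, edge x y].
  by have := card_gp_edge n4 xS yS xy; case: (leqP n 7); lia.
have S_indep : {in S &, forall x y, ~~ edge x y}.
  move=> x y xS yS; apply: contra noedge => xy.
  by apply/existsP; exists x; rewrite xS; apply/existsP; exists y; rewrite yS.
by have [_|n8] := leqP n 7; [apply: card_indep_le | apply: card_indep_le6].
Qed.

End UpperBound.

(** * Lower bound *)

Lemma gp_lower_bound (S : {set G}) : general_position S -> #|S| <= gp G.
Proof. by move=> gpS; apply: bigmax_sup (leqnn _); apply/asboolP. Qed.

(** Cycle distances are at most 3 here, and two distances that are at least 2 add up to at least
    4. *)
Lemma gp_ge_n : n <= 7 -> n <= gp G.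
Proof.
move=> n7; pose S : {set G} := [set mk_vertex i true | i : 'I_n].
have Sn : #|S| = n by rewrite card_imset ?card_ord // => i j [].
have dS u v : u \in S -> v \in S -> u != v -> 2 <= d u v <= 3.
  case/imsetP=> i _ -> /imsetP[j _ ->]; rewrite vertex_eqE /= andbT /d /= => ij.
  have [E|ij1|ij2] := cycle_dist_cases (ltn_ord i) (ltn_ord j).
  - by rewrite E eqxx in ij.
  - by rewrite shadow_dist_near //=; case: (n == 3).
  - by rewrite shadow_dist_far // ij2 /cycle_dist; lia.
rewrite -[leqLHS]Sn; apply/gp_lower_bound/shadow_cycle_gpP => u v w uS vS wS uv vw uw.
have := dS u v uS vS uv; have := dS v w vS wS vw; have := dS u w uS wS uw.
by move: (d u v) (d v w) (d u w) => ? ? ?; clear; lia.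
Qed.

Lemma gp_ge_6 : 8 <= n -> 6 <= gp G.
Proof.
(* The points 0, [a] and [b] cut the cycle into three arcs, each of length at least 2 and less than
   half of [n]; only these inequalities are kept. *)
move=> n8; pose a := n %/ 3; pose b := n.*2 %/ 3.
have [a2 an [ab2 abn] [b2 bn]] : [/\ 1 < a, a.*2 < n, (a.+1 < b /\ (b - a).*2 < n) &
    (b.+1 < n /\ n < b.*2)] by rewrite /a /b; split; lia.
clearbody a b.
have [l0 la lb] : [/\ 0 < n, a < n & b < n] by split; lia.
pose I : {set 'I_n} := [set Ordinal l0; Ordinal la; Ordinal lb].
have ordE (k l : 'I_n) : (k == l) = (k == l :> nat) by [].
have I3 : #|I| = 3.
  rewrite /I -setUA cardsU1 cards2 !inE !ordE /=.
  by have -> : (0 == a) || (0 == b) = false by [lia]; have -> : (a != b) by lia.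
pose S : {set G} := [set mk_vertex p.1 p.2 | p in setX I [set: bool]].
have S6 : #|S| = 6.
  rewrite card_imset ?cardsX ?I3 ?cardsT ?card_bool //.
  move=> [i e] [j f] /= E; have := congr1 base E; have := congr1 is_shadow E.
  by rewrite !base_mk !is_shadow_mk => -> ->.
rewrite -[leqLHS]S6; apply/gp_lower_bound/shadow_cycle_gpP.
have baseS u : u \in S -> [\/ base u = 0 :> nat, base u = a :> nat | base u = b :> nat].
  case/imsetP=> -[i e] /setXP[/= + _] ->; rewrite base_mk !inE -orbA !ordE /=.
  by case/or3P=> /eqP ->; [constructor 1 | constructor 2 | constructor 3].
have dist0a : cycle_dist n 0 a = a by rewrite cycle_dist_short; lia.
have distab : cycle_dist n a b = b - a by rewrite cycle_dist_short; lia.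
have dist0b : cycle_dist n 0 b = n - b by rewrite cycle_dist_long; lia.
have dS u v : u \in S -> v \in S -> u != v ->
    d u v = if base u == base v :> nat then 2 else cycle_dist n (base u) (base v).
  rewrite vertex_eqE /d => /baseS uS /baseS vS.
  have [->|ne _] := eqVneq (nat_of_ord (base u)) (base v).
    by move=> /= /negPf ne; rewrite shadow_dist_twin ne.
  rewrite shadow_dist_far //.
  by case: uS ne => ->; case: vS => -> ne; move: ne; rewrite ?eqxx //;
     rewrite ?[cycle_dist n _ 0]cycle_distC ?[cycle_dist n b a]cycle_distC
       ?dist0a ?distab ?dist0b; lia.
(* Over three different points the distances are the three arcs, each shorter than the sum of the
   other two. If exactly two vertices share a point, the distances are 2, D and D with D at least
   2. *)
move=> u v w uS vS wS uv vw uw; rewrite !dS //.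
have [a0 b0 ba] : [/\ (a == 0) = false, (b == 0) = false & (b == a) = false].
  by split; lia.
case: (baseS u uS) => ->; case: (baseS v vS) => ->; case: (baseS w wS) => ->;
  rewrite ?eqxx ?[0 == _]eq_sym ?[a == b]eq_sym ?a0 ?b0 ?ba
  ?[cycle_dist n _ 0]cycle_distC ?[cycle_dist n b a]cycle_distC
  ?dist0a ?distab ?dist0b; clear - a2 an ab2 abn b2 bn; lia.
Qed.

End ShadowCycle.

Theorem theorem3p8 (n : nat) (hn : 3 <= n) :
  gp (shadow_graph (cycle_graph n)) = if n <= 7 then n else 6.
Proof.
apply/eqP; rewrite eqn_leq; apply/andP; split.
  by apply/bigmax_leqP => S /asboolP gpS; apply: card_gp_le.
by have [n7|n8] := leqP n 7; [apply: gp_ge_n | apply: gp_ge_6].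
Qed.
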